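(* Let $n=2m$, let $r\ge 0$ be an integer, and let $\Lambda\in\mathbb{F}_{2^m}[x]$ be a linearized polynomial that is a permutation of $\mathbb{F}_{2^m}$. Let $F:\mathbb{F}_{2^n}\to\mathbb{F}_{2^n}$, $F(x)=x^{2^r}\,\mathrm{Tr}^n_m(\Lambda(x))$, and $H:\mathbb{F}_{2^m}\to\mathbb{F}_{2^m}$, $H(x)=x^{2^r}\Lambda(x)$. Then for all $b\in\mathbb{F}_{2^n}$: (1) if $a\in\mathbb{F}_{2^m}^*$, then $\delta_F(a,b)\in\{0,2^m\}$; (2) if $a\in\mathbb{F}_{2^n}\setminus\mathbb{F}_{2^m}$, then $\delta_F(a,b)\in\{0,2^s\}$, where, with $c=\mathrm{Tr}^n_m(a)$, $s$ is the $\mathbb{F}_2$-dimension of the solution space in $\mathbb{F}_{2^m}$ of the equation $z^{2^r}\Lambda(c)+c^{2^r}\Lambda(z)=0$ in $z$; i.e., $\delta_F(a,b)=\delta_H(\mathrm{Tr}^n_m(a),d)\in\{0,2^s\}$ for some $d\in\mathbb{F}_{2^m}$.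
   Context: A linearized polynomial over $\mathbb{F}_{2^m}$ is one of the form $\sum_i c_i x^{2^i}$ with $c_i\in\mathbb{F}_{2^m}$. $\mathrm{Tr}^n_m(x)=x+x^{2^m}$ is the relative trace $\mathbb{F}_{2^n}\to\mathbb{F}_{2^m}$. For $G:\mathbb{F}_{2^k}\to\mathbb{F}_{2^k}$, $a\in\mathbb{F}_{2^k}^*$, $b\in\mathbb{F}_{2^k}$, $\delta_G(a,b)=|\{x\in\mathbb{F}_{2^k}: G(x+a)+G(x)=b\}|$. *)

(* Defs.v *)
From HB Require Import structures.
From mathcomp Require Import all_boot all_order all_fingroup all_algebra.
From mathcomp Require Import all_solvable all_field.

Set Implicit Arguments.
Unset Strict Implicit.
Unset Printing Implicit Defensive.

Import GRing.Theory.
Local Open Scope ring_scope.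

(* The finite field with 2 ^ k elements is a field extension of 'F_2 of
   dimension k; [finvect_type] only provides its finType structure. *)

Definition delta (E : fieldExtType 'F_2) (G : E -> E) (a b : E) : nat :=
  #|[set x : finvect_type E | G ((x : E) + a) + G (x : E) == b]|.

Definition linearized (E : fieldExtType 'F_2) (p : {poly E}) : Prop :=
  exists (N : nat) (c : nat -> E), p = \sum_(i < N) c i *: 'X^(2 ^ i).

Definition permutation_poly (E : fieldExtType 'F_2) (p : {poly E}) : Prop :=
  bijective (fun x : E => p.[x]).

(* [vsproj K] is used only to give the codomain type [subvs_of K]: its argument
   lies in K when K has dimension m and L has dimension 2 * m, see [relTraceE]. *)
Definition relTrace (L : fieldExtType 'F_2) (K : {subfield L}) (m : nat)
    (x : L) : subvs_of K :=
  vsproj K (x + x ^+ (2 ^ m)).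

Definition funF (L : fieldExtType 'F_2) (K : {subfield L}) (m r : nat)
    (Lam : {poly subvs_of K}) (x : L) : L :=
  x ^+ (2 ^ r) * vsval (relTrace K m (map_poly vsval Lam).[x]).

Definition funH (E : fieldExtType 'F_2) (r : nat) (Lam : {poly E}) (x : E) : E :=
  x ^+ (2 ^ r) * Lam.[x].

(* [linfun f] is f itself as f is linear, see [mem_solspace]. *)
Definition solspace (E : fieldExtType 'F_2) (r : nat) (Lam : {poly E}) (c : E) :
    {vspace E} :=
  lker (linfun (fun z : E => z ^+ (2 ^ r) * Lam.[c] + c ^+ (2 ^ r) * Lam.[z])).

Lemma relTraceE (L : fieldExtType 'F_2) (K : {subfield L}) (n m : nat) (x : L) :
  n = (2 * m)%N -> \dim {:L} = n -> \dim K = m ->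
  vsval (relTrace K m x) = x + x ^+ (2 ^ m).
Proof.
move=> -> dL dK; rewrite /relTrace vsprojK //.
have ch2 : 2 \in [pchar L] by rewrite (pchar_lalg L) pchar_Fp.
have fx : x ^+ (2 ^ (2 * m)) = x.
  have /eqP := memvf x.
  by rewrite (Fermat's_little_theorem {:L}%AS) card_Fp // dL => /eqP/eqP.
rewrite Fermat's_little_theorem card_Fp // dK exprDn_pchar ?pnatX ?pnatE ?ch2 //.
by rewrite -exprM -expnD addnn -mul2n fx addrC.
Qed.

Lemma expr2n_linear (E : fieldExtType 'F_2) (i : nat) :
  linear (fun z : E => z ^+ (2 ^ i)).
Proof.
have ch2 : 2 \in [pchar E] by rewrite (pchar_lalg E) pchar_Fp.
move=> k u v; rewrite exprDn_pchar ?pnatX ?pnatE ?ch2 // exprZn; congr (_ *: _ + _).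
elim: i => [|i IH]; first by rewrite expr1.
by have := expf_card k; rewrite card_Fp // expnSr exprM IH.
Qed.

Lemma mem_solspace (E : fieldExtType 'F_2) (r : nat) (Lam : {poly E}) (c z : E) :
  linearized Lam ->
  (z \in solspace r Lam c) =
    (z ^+ (2 ^ r) * Lam.[c] + c ^+ (2 ^ r) * Lam.[z] == 0).
Proof.
case=> N [l defLam]; rewrite /solspace; set f := fun z : E => _.
have LamE w : Lam.[w] = \sum_(i < N) l i * w ^+ (2 ^ i).
  by rewrite defLam horner_sum; apply: eq_bigr => i _; rewrite hornerZ hornerXn.
have lf : linear f.
  move=> k u v; rewrite /f expr2n_linear !(LamE (k *: u + v)).
  have -> : \sum_(i < N) l i * (k *: u + v) ^+ (2 ^ i) = k *: Lam.[u] + Lam.[v].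
    rewrite !LamE scaler_sumr -big_split; apply: eq_bigr => i _ /=.
    by rewrite expr2n_linear mulrDr scalerAr.
  by rewrite mulrDl mulrDr -scalerAl -scalerAr scalerDr addrACA.
pose fL := GRing.isLinear.Build _ _ _ _ f lf.
pose g : {linear E -> E} := HB.pack f fL.
by rewrite memv_ker -[f]/(g : E -> E) lfunE.
Qed.

(* Main.v *)
(** With [R = 2 ^ r], [T] the relative trace and [c = T a], the derivative of
    [F] in direction [a] is [a^R Lam(T x) + x^R Lam(c) + a^R Lam(c)].
    If [a] is in [K] then [c = 0] and the nonempty fibres are cosets of
    [ker T = K].  Otherwise, applying [T] to the equation shows that [T x] solves
    the equation of [H] with right hand side [T b]; conversely a solution [u] of
    the latter determines [x^R], hence [x], from the former with [T x]
    replaced by [u], and then [T x = u].  So [delta_F(a,b) = delta_H(c, T b)]. *)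

Require Import Defs.
From HB Require Import structures.
From mathcomp Require Import all_boot all_order all_fingroup all_algebra.
From mathcomp Require Import all_solvable all_field.

Set Implicit Arguments.
Unset Strict Implicit.
Unset Printing Implicit Defensive.

Import GRing.Theory.
Local Open Scope ring_scope.

Section Characteristic2.

Variable E : fieldExtType 'F_2.
Implicit Types (x y : E) (Lam : {poly E}).

Lemma pchar_F2ext : 2 \in [pchar E].
Proof. by rewrite (pchar_lalg E) pchar_Fp. Qed.

Lemma expr2nD (r : nat) x y :
  (x + y) ^+ (2 ^ r) = x ^+ (2 ^ r) + y ^+ (2 ^ r).
Proof. by have := expr2n_linear r 1 x y; rewrite !scale1r. Qed.

Lemma expr2n_inj (r : nat) : injective (fun x : E => x ^+ (2 ^ r)).
Proof.
move=> x y /= exy; apply/eqP; rewrite -subr_eq0 (oppr_pchar2 pchar_F2ext).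
have : (x + y) ^+ (2 ^ r) == 0 by rewrite expr2nD exy addrr_pchar2 ?pchar_F2ext.
by rewrite expf_eq0 => /andP[].
Qed.

Lemma expr2n_surj (r : nat) y : exists x, x ^+ (2 ^ r) = y.
Proof.
have inj : injective (fun x : finvect_type E => (x : E) ^+ (2 ^ r) : finvect_type E).
  exact: expr2n_inj.
by have [g _ gK] := injF_bij inj; exists (g y); apply: gK.
Qed.

Lemma linearizedD Lam x y :
  linearized Lam -> Lam.[x + y] = Lam.[x] + Lam.[y].
Proof.
case=> N [l ->]; rewrite !horner_sum -big_split; apply: eq_bigr => i _ /=.
by rewrite !hornerZ !hornerXn expr2nD mulrDr.
Qed.

Lemma linearized0 Lam : linearized Lam -> Lam.[0] = 0.
Proof. by move/(linearizedD 0 0)/eqP; rewrite addr0 -subr_eq subrr eq_sym => /eqP. Qed.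

Lemma permutation_linearized_eq0 Lam x :
  linearized Lam -> permutation_poly Lam -> (Lam.[x] == 0) = (x == 0).
Proof.
by move=> lin /bij_inj inj; rewrite -[RHS](inj_eq inj) (linearized0 lin).
Qed.

(** Translation by a point of a nonempty fibre carries it bijectively onto [V]. Both dichotomies of
    the theorem come from this, with [V] the subfield [K] or the solution space. *)
Lemma card_fibre_coset (V : {vspace E}) (f : E -> E) (b : E) :
    (forall x y, (f x == f y) = (x - y \in V)) ->
  #|[set x : finvect_type E | f (x : E) == b]| = 0%N \/
  #|[set x : finvect_type E | f (x : E) == b]| = (2 ^ \dim V)%N.
Proof.
move=> fV; set S := [set _ | _].
have [-> | [x0]] := set_0Vmem S; [by left; rewrite cards0 | rewrite inE => /eqP fx0].
have := @card_vspace _ (finvect_type E) _ V; rewrite card_Fp // => <-; right.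
pose shift (x : finvect_type E) : finvect_type E := x - x0.
have shift_inj : injective shift by apply: addIr.
rewrite -[RHS](on_card_preimset (onW_bij _ (injF_bij shift_inj))).
by apply: eq_card => x; rewrite !inE -fx0 fV.
Qed.

Lemma funH_derivative (r : nat) Lam x c : linearized Lam ->
  funH r Lam (x + c) + funH r Lam x =
    x ^+ (2 ^ r) * Lam.[c] + c ^+ (2 ^ r) * Lam.[x] + c ^+ (2 ^ r) * Lam.[c].
Proof.
move=> lin; rewrite /funH linearizedD // expr2nD mulrDl !mulrDr addrAC.
(* The two copies of x^R Lam(x) become adjacent and cancel in characteristic 2. *)
rewrite [_ * Lam.[x] + _ + _]addrAC.
by rewrite addrr_pchar2 ?pchar_F2ext // add0r addrA.
Qed.

End Characteristic2.

Section RelativeTrace.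

Variables (m r : nat) (L : fieldExtType 'F_2) (K : {subfield L}).
Variable Lam : {poly subvs_of K}.
Hypotheses (hL : \dim {:L} = (2 * m)%N) (hK : \dim K = m).
Hypothesis hlin : linearized Lam.
Implicit Types (x y a b : L) (k : subvs_of K).

Let T := relTrace K m.

Lemma val_relTrace x : vsval (T x) = x + x ^+ (2 ^ m).
Proof. exact: (relTraceE x erefl hL hK). Qed.

Lemma relTraceD x y : T (x + y) = T x + T y.
Proof. by apply: val_inj; rewrite /= !val_relTrace expr2nD addrACA. Qed.

Lemma mem_subfield_expr x : (x \in K) = (x ^+ (2 ^ m) == x).
Proof. by rewrite Fermat's_little_theorem card_Fp // hK. Qed.

(** In characteristic 2, x + x^(2^m) = 0 is the equation x^(2^m) = x that cuts out [K]. *)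
Lemma relTrace_eq0 x : (T x == 0) = (x \in K).
Proof.
rewrite -(inj_eq val_inj) /= val_relTrace mem_subfield_expr eq_sym -subr_eq0.
by rewrite sub0r (oppr_pchar2 (pchar_F2ext L)) addrC addr_eq0 (oppr_pchar2 (pchar_F2ext L)).
Qed.

Lemma relTraceMr x k : T (x * vsval k) = T x * k.
Proof.
apply: val_inj; rewrite /= !val_relTrace exprMn mulrDl.
by have := subvsP k; rewrite mem_subfield_expr => /eqP->.
Qed.

Lemma relTrace_expr2n (s : nat) x : T (x ^+ (2 ^ s)) = T x ^+ (2 ^ s).
Proof.
apply: val_inj; rewrite rmorphXn /= !val_relTrace expr2nD.
by congr (_ + _); rewrite -!exprM mulnC.
Qed.

(** [T] is [K]-linear and commutes with powers of Frobenius, so it passes through each monomial of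
    [Lam]. Hence F(x) = x^R Lam(T x). *)
Lemma relTrace_horner x : T (map_poly vsval Lam).[x] = Lam.[T x].
Proof.
case: hlin => N [l ->]; rewrite rmorph_sum /= !horner_sum.
have T0 : T 0 = 0 by apply/eqP; rewrite relTrace_eq0 mem0v.
rewrite (big_morph T relTraceD T0); apply: eq_bigr => i _ /=.
rewrite map_polyZ map_polyXn !hornerZ !hornerXn.
by rewrite mulrC relTraceMr relTrace_expr2n mulrC.
Qed.

Lemma funF_derivative a x :
  funF m r Lam (x + a) + funF m r Lam x =
    x ^+ (2 ^ r) * vsval Lam.[T a] + a ^+ (2 ^ r) * vsval Lam.[T x]
    + a ^+ (2 ^ r) * vsval Lam.[T a].
Proof.
rewrite /funF -/T !relTrace_horner relTraceD linearizedD // expr2nD rmorphD /=.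
rewrite mulrDl !mulrDr addrAC [_ * vsval Lam.[T x] + _ + _]addrAC.
by rewrite addrr_pchar2 ?pchar_F2ext // add0r addrA.
Qed.

(** Up to a constant, the derivative of H in direction c is the additive map whose kernel is
    [solspace r Lam c]. *)
Lemma delta_funH_dichotomy (c d : subvs_of K) :
  delta (funH r Lam) c d = 0%N \/
  delta (funH r Lam) c d = (2 ^ \dim (solspace r Lam c))%N.
Proof.
pose D u := funH r Lam (u + c) + funH r Lam u.
apply: (@card_fibre_coset _ (solspace r Lam c) D d) => u v.
rewrite /D !funH_derivative // (inj_eq (addIr _)).
rewrite mem_solspace // (oppr_pchar2 (pchar_F2ext _)) expr2nD linearizedD //.
by rewrite mulrDl mulrDr addrACA addr_eq0 (oppr_pchar2 (pchar_F2ext _)).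
Qed.

Hypothesis hperm : permutation_poly Lam.

Lemma delta_funF_subfield a b : a \in K -> a != 0 ->
  delta (funF m r Lam) a b = 0%N \/ delta (funF m r Lam) a b = (2 ^ m)%N.
Proof.
move=> Ka a0; have Ta : T a = 0 by apply/eqP; rewrite relTrace_eq0.
pose D x := funF m r Lam (x + a) + funF m r Lam x.
rewrite -[X in (2 ^ X)%N]hK; apply: (@card_fibre_coset _ K D b) => x y.
rewrite /D !funF_derivative Ta (linearized0 hlin) !mulr0 !addr0 !add0r.
(* Only a^R Lam(T x) is left; as a is nonzero and [Lam] is injective, it determines T x. *)
rewrite (inj_eq (mulfI (expf_neq0 _ a0))) (inj_eq val_inj).
rewrite (inj_eq (bij_inj hperm)) (oppr_pchar2 (pchar_F2ext _)) -relTrace_eq0.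
by rewrite relTraceD addr_eq0 (oppr_pchar2 (pchar_F2ext _)).
Qed.

Lemma delta_funF_funH a b : a \notin K ->
  delta (funF m r Lam) a b = delta (funH r Lam) (T a) (T b).
Proof.
move=> nKa; set c := T a.
(* Here a outside [K] is used: c is nonzero, so one may divide by Lam(c). *)
have Lc0 : Lam.[c] != 0 by rewrite permutation_linearized_eq0 // relTrace_eq0.
have vLc0 : vsval Lam.[c] != 0 by rewrite (inj_eq val_inj Lam.[c] 0).
set SF := [set x : finvect_type L |
  funF m r Lam ((x : L) + a) + funF m r Lam (x : L) == b].
pose T' (x : finvect_type L) : finvect_type (subvs_of K) := T x.
(* [T] is injective on the fibre: T x fixes x^R Lam(c), hence x. *)
rewrite /delta -/SF -(@card_in_imset _ _ T' SF); last first.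
  move=> x y; rewrite !inE !funF_derivative => /eqP <- /eqP + eT.
  rewrite -[T y]/(T' y) -eT => /addIr/addIr/(mulIf vLc0).
  by move/esym; apply: expr2n_inj.
apply: eq_card => u; rewrite inE.
apply/imsetP/idP => [[x + ->] | /eqP Hu].
  rewrite inE funF_derivative => /eqP <-; rewrite funH_derivative // -/c.
  by rewrite !relTraceD !relTraceMr !relTrace_expr2n.
(* The right-hand side is the derivative equation of F solved for x^R, with u in place of T x. *)
have [x xR] := expr2n_surj r ((b - a ^+ (2 ^ r) * vsval Lam.[c]
  - a ^+ (2 ^ r) * vsval Lam.[(u : subvs_of K)]) / vsval Lam.[c]).
have xRc : x ^+ (2 ^ r) * vsval Lam.[c]
    + a ^+ (2 ^ r) * vsval Lam.[(u : subvs_of K)] + a ^+ (2 ^ r) * vsval Lam.[c] = b.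
  by rewrite xR divfK // !subrK.
(* Applying [T] to [xRc] gives (T x)^R Lam(c) + c^R Lam(u) + c^R Lam(c) = T b. The equation of H at
   u is the same with u^R for (T x)^R, so the two powers agree. *)
have Tx : T x = u.
  apply: (@expr2n_inj _ r); apply: (mulIf Lc0).
  apply: (addIr (c ^+ (2 ^ r) * Lam.[(u : subvs_of K)])).
  apply: (addIr (c ^+ (2 ^ r) * Lam.[c])).
  rewrite -funH_derivative // Hu -xRc.
  by rewrite !relTraceD !relTraceMr !relTrace_expr2n.
by exists x => //; rewrite inE funF_derivative Tx -/c xRc.
Qed.

End RelativeTrace.

Theorem theorem3 (n m r : nat) (L : fieldExtType 'F_2) (K : {subfield L})
    (Lam : {poly subvs_of K}) (hn : n = (2 * m)%N)
    (hL : \dim {:L} = n) (hK : \dim K = m)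
    (hlin : linearized Lam) (hperm : permutation_poly Lam) :
  forall b : L,
    (forall a : L, a \in K -> a != 0 ->
       delta (funF m r Lam) a b = 0%N \/
       delta (funF m r Lam) a b = (2 ^ m)%N) /\
    (forall a : L, a \notin K ->
       let c := relTrace K m a in
       let s := \dim (solspace r Lam c) in
       (delta (funF m r Lam) a b = 0%N \/
        delta (funF m r Lam) a b = (2 ^ s)%N) /\
       exists d : subvs_of K,
         delta (funF m r Lam) a b = delta (funH r Lam) c d).
Proof.
rewrite hn in hL => b; split=> [a Ka a0 | a nKa c s].
  exact: delta_funF_subfield.
rewrite (delta_funF_funH r hL hK hlin hperm b nKa).
by split; [apply: delta_funH_dichotomy | exists (relTrace K m b)].
Qed.
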